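(* Let $Q$ be a subset of the group $\mathrm{Aff}_+(\mathbb R)$. Then $Q$ is a Kazhdan set in $\mathrm{Aff}_+(\mathbb R)$ if and only if the set $Q_0=\{t\in\mathbb R:\ \exists\,b\in\mathbb R,\ (e^t,b)\in Q\}$ is a Kazhdan set in $\mathbb R$.
   Context: $\mathrm{Aff}_+(\mathbb R)$ is the group of orientation-preserving affine homeomorphisms of $\mathbb R$, realized as $(0,+\infty)\times\mathbb R$ with the usual topology and group law $(a,b)(a',b')=(aa',b+ab')$. For a topological group $G$, a subset $Q$ is a Kazhdan set in $G$ if there exists $\varepsilon>0$ such that every strongly continuous unitary representation $\pi$ of $G$ on a complex Hilbert space having a vector $x$ with $\sup_{g\in Q}\|\pi(g)x-x\|<\varepsilon\|x\|$ has a non-zero $G$-invariant vector. *)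

(* Defs.v *)
From Stdlib Require Import Reals Lra.
Open Scope R_scope.

Definition Cx : Type := (R * R)%type.
Definition Cre (z : Cx) : R := fst z.
Definition Cim (z : Cx) : R := snd z.
Definition C0 : Cx := (0, 0).
Definition C1 : Cx := (1, 0).
Definition Cadd (z w : Cx) : Cx := (fst z + fst w, snd z + snd w).
Definition Cmul (z w : Cx) : Cx :=
  (fst z * fst w - snd z * snd w, fst z * snd w + snd z * fst w).
Definition Cconj (z : Cx) : Cx := (fst z, - snd z).

Record CHilbert := {
  hv :> Type;
  hadd : hv -> hv -> hv;
  hzero : hv;
  hopp : hv -> hv;
  hscal : Cx -> hv -> hv;
  hinner : hv -> hv -> Cx;
  hadd_assoc : forall x y z, hadd x (hadd y z) = hadd (hadd x y) z;
  hadd_comm : forall x y, hadd x y = hadd y x;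
  hadd_0l : forall x, hadd hzero x = x;
  hadd_oppl : forall x, hadd (hopp x) x = hzero;
  hscal_1 : forall x, hscal C1 x = x;
  hscal_assoc : forall a b x, hscal a (hscal b x) = hscal (Cmul a b) x;
  hscal_addr : forall a x y, hscal a (hadd x y) = hadd (hscal a x) (hscal a y);
  hscal_addl : forall a b x, hscal (Cadd a b) x = hadd (hscal a x) (hscal b x);
  hinner_addl : forall x y z, hinner (hadd x y) z = Cadd (hinner x z) (hinner y z);
  hinner_scall : forall a x y, hinner (hscal a x) y = Cmul a (hinner x y);
  hinner_sym : forall x y, hinner y x = Cconj (hinner x y);
  hinner_pos : forall x, 0 <= Cre (hinner x x);
  hinner_def : forall x, Cre (hinner x x) = 0 -> x = hzero;
  hcomplete : forall u : nat -> hv,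
    (forall eps, 0 < eps -> exists N, forall m n, (N <= m)%nat -> (N <= n)%nat ->
        sqrt (Cre (hinner (hadd (u m) (hopp (u n))) (hadd (u m) (hopp (u n))))) < eps) ->
    exists l, forall eps, 0 < eps -> exists N, forall n, (N <= n)%nat ->
        sqrt (Cre (hinner (hadd (u n) (hopp l)) (hadd (u n) (hopp l)))) < eps
}.

Arguments hadd {c}. Arguments hzero {c}. Arguments hopp {c}.
Arguments hscal {c}. Arguments hinner {c}.

Definition hnorm {H : CHilbert} (x : H) : R := sqrt (Cre (hinner x x)).
Definition hdist {H : CHilbert} (x y : H) : R := hnorm (hadd x (hopp y)).

(* A topological group given by its carrier, law, unit, and a metric
   inducing its topology. *)
Record TopGrp := {
  tg :> Type;
  tg_mul : tg -> tg -> tg;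
  tg_one : tg;
  tg_dist : tg -> tg -> R
}.
Arguments tg_mul {t}. Arguments tg_one {t}. Arguments tg_dist {t}.

Definition unitary_rep (G : TopGrp) (H : CHilbert) (pi : G -> H -> H) : Prop :=
  (forall g x y, pi g (hadd x y) = hadd (pi g x) (pi g y)) /\
  (forall g a x, pi g (hscal a x) = hscal a (pi g x)) /\
  (forall g x y, hinner (pi g x) (pi g y) = hinner x y) /\
  (forall g y, exists x, pi g x = y) /\
  (forall g h x, pi (tg_mul g h) x = pi g (pi h x)) /\
  (forall x, pi tg_one x = x) /\
  (forall x g0 eps, 0 < eps -> exists delta, 0 < delta /\
      forall g, tg_dist g g0 < delta -> hdist (pi g x) (pi g0 x) < eps).

(* Kazhdan set.  "sup_{g in Q} ||pi g x - x|| < eps ||x||" is written as: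
   there is c >= 0 (the sup of nonnegative quantities, 0 if Q is empty)
   with c < eps ||x|| bounding all ||pi g x - x||, g in Q. *)
Definition Kazhdan_set (G : TopGrp) (Q : G -> Prop) : Prop :=
  exists eps, 0 < eps /\
    forall (H : CHilbert) (pi : G -> H -> H), unitary_rep G H pi ->
      forall x : H,
        (exists c, 0 <= c /\ c < eps * hnorm x /\
           forall g, Q g -> hdist (pi g x) x <= c) ->
        exists v : H, v <> hzero /\ forall g, pi g v = v.

Definition Radd_grp : TopGrp :=
  {| tg := R; tg_mul := Rplus; tg_one := 0; tg_dist := fun s t => Rabs (s - t) |}.

Definition Aff : Type := { p : R * R | 0 < fst p }.

Definition Aff_mul (g h : Aff) : Aff.
Proof.
  destruct g as [[a b] ha]; destruct h as [[a' b'] ha'].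
  exists (a * a', b + a * b'). simpl in *. now apply Rmult_lt_0_compat.
Defined.

Definition Aff_one : Aff.
Proof. exists (1, 0). simpl. lra. Defined.

Definition Aff_dist (g h : Aff) : R :=
  let '(a, b) := proj1_sig g in let '(a', b') := proj1_sig h in
  sqrt ((a - a') ^ 2 + (b - b') ^ 2).

Definition Aff_grp : TopGrp :=
  {| tg := Aff; tg_mul := Aff_mul; tg_one := Aff_one; tg_dist := Aff_dist |}.

Definition Q0 (Q : Aff -> Prop) (t : R) : Prop :=
  exists g : Aff, Q g /\ fst (proj1_sig g) = exp t.

(* Main.v *)
Require Import Defs.
From Stdlib Require Import Reals.
From Stdlib Require Import Lra Lia Classical ClassicalEpsilon ProofIrrelevance.

(** For the hard direction, let [N] be the translation subgroup of [Aff].  A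
    bounded set is not Kazhdan in [R] (slow characters almost fix it), so [Q0] is
    unbounded.  Given a representation of [Aff] and a vector [x], the element [y]
    of minimal norm of the closed convex hull of [N x] is the orthogonal projection
    of [x] on the [N]-invariant vectors.  Since [n_s g = g n_(s/a)] for
    [g = (a, b)], the vector [g u] is almost fixed by any given element of [N] as
    [a] tends to infinity (Mautner phenomenon); hence [<g u, x>] is close to
    [<g u, w>] for each [w] in the hull, and [<g u, x - y>] tends to [0].  So
    elements of [Q] with [|t|] large move [z = x - y] by about [sqrt 2 * |z|]; if
    [x] is almost [Q]-invariant, [z] is small and [y] is an almost [Q0]-invariant
    vector of the representation of [R] on the [N]-invariant vectors. *)

(** * Real inner product geometry *)

(** The real part alone determines norms and distances, so all the geometry below takes place in the
    underlying real inner product space. *)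
Definition rin {H : CHilbert} (x y : H) : R := Cre (hinner x y).

Lemma rin_sym {H : CHilbert} (x y : H) : rin x y = rin y x.
Proof. unfold rin. rewrite (hinner_sym _ y x). reflexivity. Qed.

Lemma rin_addl {H : CHilbert} (x y z : H) : rin (hadd x y) z = rin x z + rin y z.
Proof. unfold rin. rewrite hinner_addl. reflexivity. Qed.

Lemma rin_addr {H : CHilbert} (x y z : H) : rin x (hadd y z) = rin x y + rin x z.
Proof. rewrite rin_sym, rin_addl, (rin_sym y), (rin_sym z). reflexivity. Qed.

Lemma rin_zerol {H : CHilbert} (y : H) : rin hzero y = 0.
Proof.
  assert (E := rin_addl hzero hzero y). rewrite hadd_0l in E. lra.
Qed.

Lemma rin_oppl {H : CHilbert} (x y : H) : rin (hopp x) y = - rin x y.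
Proof.
  assert (E := rin_addl (hopp x) x y).
  rewrite hadd_oppl, rin_zerol in E. lra.
Qed.

Lemma rin_oppr {H : CHilbert} (x y : H) : rin x (hopp y) = - rin x y.
Proof. rewrite rin_sym, rin_oppl, rin_sym. reflexivity. Qed.

Definition rscal {H : CHilbert} (c : R) (x : H) : H := hscal (c, 0) x.

Lemma rin_rscall {H : CHilbert} (c : R) (x y : H) : rin (rscal c x) y = c * rin x y.
Proof. unfold rin, rscal. rewrite hinner_scall. unfold Cre, Cmul; simpl. ring. Qed.

Lemma rin_rscalr {H : CHilbert} (c : R) (x y : H) : rin x (rscal c y) = c * rin x y.
Proof. rewrite rin_sym, rin_rscall, rin_sym. reflexivity. Qed.

Ltac rin_expand :=
  repeat rewrite ?rin_addl, ?rin_addr, ?rin_oppl, ?rin_oppr, ?rin_rscall, ?rin_rscalr.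

Lemma rin_pos {H : CHilbert} (x : H) : 0 <= rin x x.
Proof. apply hinner_pos. Qed.

Lemma hnorm_ge0 {H : CHilbert} (x : H) : 0 <= hnorm x.
Proof. apply sqrt_pos. Qed.

Lemma hnorm_sqr {H : CHilbert} (x : H) : hnorm x * hnorm x = rin x x.
Proof. apply sqrt_sqrt, hinner_pos. Qed.

Lemma hdist_ge0 {H : CHilbert} (x y : H) : 0 <= hdist x y.
Proof. apply hnorm_ge0. Qed.

Lemma hdist_sqr {H : CHilbert} (x y : H) :
  hdist x y * hdist x y = rin x x - 2 * rin x y + rin y y.
Proof.
  unfold hdist. rewrite hnorm_sqr. rin_expand. rewrite (rin_sym y x). ring.
Qed.

Lemma hopp_unique {H : CHilbert} (x y : H) : hadd x y = hzero -> x = hopp y.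
Proof.
  intros E. rewrite <- (hadd_0l _ x), <- (hadd_oppl _ y), <- hadd_assoc.
  rewrite (hadd_comm _ y x), E, hadd_comm, hadd_0l. reflexivity.
Qed.

Lemma hoppK {H : CHilbert} (x : H) : hopp (hopp x) = x.
Proof. symmetry. apply hopp_unique. rewrite hadd_comm. apply hadd_oppl. Qed.

Lemma hdist_eq0 {H : CHilbert} (x y : H) : hdist x y = 0 -> x = y.
Proof.
  intros E. rewrite <- (hoppK y). apply hopp_unique, hinner_def.
  change (rin (hadd x (hopp y)) (hadd x (hopp y)) = 0).
  rewrite <- hnorm_sqr. change (hdist x y * hdist x y = 0). rewrite E. ring.
Qed.

Lemma Rle_of_sqr (a b : R) : 0 <= b -> a * a <= b * b -> a <= b.
Proof. intros; nra. Qed.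

Lemma Rabs_bounds (a b : R) : Rabs a <= b -> - b <= a <= b.
Proof. unfold Rabs. destruct (Rcase_abs a); lra. Qed.

Lemma cauchy_schwarz {H : CHilbert} (x y : H) : Rabs (rin x y) <= hnorm x * hnorm y.
Proof.
  (* Up to the factor [rin y y], this vector is the component of [x] orthogonal to [y]; its squared
     norm is [rin y y] times the Gram determinant. *)
  assert (P := rin_pos (hadd (rscal (rin y y) x) (hopp (rscal (rin x y) y)))).
  revert P. rin_expand. rewrite (rin_sym y x). intros P.
  assert (Px := rin_pos x). assert (Py := rin_pos y).
  apply Rle_of_sqr.
  { apply Rmult_le_pos; apply hnorm_ge0. }
  replace (hnorm x * hnorm y * (hnorm x * hnorm y))
    with ((hnorm x * hnorm x) * (hnorm y * hnorm y)) by ring.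
  rewrite !hnorm_sqr.
  assert (A : Rabs (rin x y) * Rabs (rin x y) = rin x y * rin x y).
  { rewrite <- Rabs_mult. apply Rabs_pos_eq. nra. }
  rewrite A.
  destruct (Req_dec (rin y y) 0) as [E|E].
  - apply hinner_def in E. subst y. rewrite rin_sym, !rin_zerol. lra.
  - assert (0 < rin y y) by lra.
    apply Rmult_le_reg_l with (rin y y); nra.
Qed.

Lemma hdist_sym {H : CHilbert} (x y : H) : hdist x y = hdist y x.
Proof.
  assert (A := hdist_sqr x y). assert (B := hdist_sqr y x).
  rewrite (rin_sym y x) in B.
  apply Rle_antisym; apply Rle_of_sqr; try apply hdist_ge0; lra.
Qed.

Lemma rin_hdist_bound {H : CHilbert} (u x y : H) :
  Rabs (rin u x - rin u y) <= hnorm u * hdist x y.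
Proof.
  replace (rin u x - rin u y) with (rin u (hadd x (hopp y))) by (rin_expand; ring).
  apply cauchy_schwarz.
Qed.

Lemma hdist_triangle {H : CHilbert} (x y z : H) : hdist x z <= hdist x y + hdist y z.
Proof.
  assert (C := cauchy_schwarz (hadd x (hopp y)) (hadd y (hopp z))).
  change (hnorm (hadd x (hopp y))) with (hdist x y) in C.
  change (hnorm (hadd y (hopp z))) with (hdist y z) in C.
  apply Rabs_bounds in C. destruct C as [_ C]. revert C. rin_expand. intros C.
  assert (A := hdist_sqr x z). assert (B := hdist_sqr x y). assert (D := hdist_sqr y z).
  assert (0 <= hdist x y) by apply hdist_ge0.
  assert (0 <= hdist y z) by apply hdist_ge0.
  apply Rle_of_sqr; lra.
Qed.

(** If [a] were positive, [eta = 1] would give [K > 0], and then [eta = a / (2 * K)] would give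
    [a <= a / 2]. *)
Lemma zero_of_bounds (a K : R) :
  0 <= a -> (forall eta, 0 < eta -> a <= eta * K) -> a <= 0.
Proof.
  intros Ha B. destruct (Rle_lt_dec a 0) as [|P]; [assumption|exfalso].
  assert (K1 := B 1 ltac:(lra)).
  assert (Q : 0 < a / (2 * K)) by (apply Rdiv_lt_0_compat; lra).
  specialize (B _ Q). field_simplify in B; lra.
Qed.

Definition midpoint {H : CHilbert} (x y : H) : H := rscal (1 / 2) (hadd x y).

(** The parallelogram law, arranged so that a lower bound on the norm of the midpoint forces two
    vectors of nearly minimal norm to be close. *)
Lemma hdist_midpoint {H : CHilbert} (x y : H) :
  hdist x y * hdist x y
  = 2 * rin x x + 2 * rin y y - 4 * rin (midpoint x y) (midpoint x y).
Proof.
  rewrite hdist_sqr. unfold midpoint. rin_expand. rewrite (rin_sym y x). field.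
Qed.

(** By the parallelogram law a minimizing sequence in [S] is Cauchy. As [S] need not be closed, its
    limit [y] is described through nearby points of [S] of nearly minimal norm. *)
Lemma minimal_norm_point {H : CHilbert} (S : H -> Prop) :
  (exists x, S x) -> (forall x y, S x -> S y -> S (midpoint x y)) ->
  exists (d : R) (y : H), (forall w, S w -> d <= rin w w) /\
    forall eta, 0 < eta -> exists w, S w /\ hdist w y < eta /\ rin w w < d + eta.
Proof.
  intros [x0 S0] Smid.
  (* The infimum of the squared norms is obtained as [- m], with [m] the supremum of their
     negatives. *)
  destruct (completeness (fun r => exists w, S w /\ r = - rin w w)) as [m [ub lub]].
  { exists 0. intros r [w [_ ->]]. assert (P := rin_pos w). lra. }
  { exists (- rin x0 x0), x0. auto. }
  assert (low : forall w, S w -> - m <= rin w w).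
  { intros w Sw. assert (- rin w w <= m) by (apply ub; eauto). lra. }
  assert (ex : forall n : nat, exists w, S w /\ rin w w < - m + / (INR n + 1)).
  { intros n. assert (0 < / (INR n + 1))
      by (apply Rinv_0_lt_compat; assert (P := pos_INR n); lra).
    apply NNPP. intros no.
    assert (m <= m - / (INR n + 1)); [|lra].
    apply lub. intros r [w [Sw ->]].
    destruct (Rle_lt_dec (- m + / (INR n + 1)) (rin w w)); [lra|].
    exfalso; apply no; eauto. }
  pose (u := fun n => proj1_sig (constructive_indefinite_description _ (ex n))).
  assert (uP : forall n, S (u n) /\ rin (u n) (u n) < - m + / (INR n + 1)).
  { intros n. unfold u. now destruct constructive_indefinite_description. }
  assert (arch : forall e, 0 < e -> exists N : nat, forall n, (N <= n)%nat ->
            / (INR n + 1) < e).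
  { intros e He. destruct (archimed_cor1 e He) as [N [HN NP]]. exists N. intros n Hn.
    apply Rle_lt_trans with (2 := HN). apply Rinv_le_contravar.
    - now apply lt_0_INR.
    - apply le_INR in Hn. lra. }
  destruct (hcomplete H u) as [y Hy].
  (* With both squared norms below [- m + e * e / 4] and that of the midpoint at least [- m], the
     squared distance is below [e * e]. *)
  { intros e He. destruct (arch (e * e / 4)) as [N HN]; [nra|].
    exists N. intros p q Hp Hq. change (hdist (u p) (u q) < e).
    destruct (uP p) as [Sp up]. destruct (uP q) as [Sq uq].
    specialize (HN p Hp) as Np. specialize (HN q Hq) as Nq.
    assert (L := low _ (Smid _ _ Sp Sq)). assert (D := hdist_midpoint (u p) (u q)).
    assert (0 <= hdist (u p) (u q)) by apply hdist_ge0. nra. }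
  exists (- m), y. split; [exact low|]. intros eta He.
  destruct (Hy eta He) as [N1 H1]. destruct (arch eta He) as [N2 H2].
  exists (u (N1 + N2)%nat). destruct (uP (N1 + N2)%nat) as [Sw uw].
  specialize (H1 (N1 + N2)%nat ltac:(lia)). specialize (H2 (N1 + N2)%nat ltac:(lia)).
  repeat split; [exact Sw | exact H1 | lra].
Qed.

(** * Unitary representations *)

Definition is_isometric {H : CHilbert} (f : H -> H) : Prop :=
  forall x y, hinner (f x) (f y) = hinner x y.

Lemma additive_opp {H : CHilbert} (f : H -> H) :
  (forall x y, f (hadd x y) = hadd (f x) (f y)) -> forall x, f (hopp x) = hopp (f x).
Proof.
  intros fD x. apply hopp_unique. rewrite <- fD, hadd_oppl.
  assert (E := fD hzero hzero). rewrite hadd_0l in E.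
  rewrite <- (hadd_0l _ (f hzero)), <- (hadd_oppl _ (f hzero)) at 1.
  rewrite <- hadd_assoc, <- E, hadd_oppl. reflexivity.
Qed.

Lemma isometric_rin {H : CHilbert} (f : H -> H) (x y : H) :
  is_isometric f -> rin (f x) (f y) = rin x y.
Proof. intros fI. unfold rin. rewrite fI. reflexivity. Qed.

Lemma isometric_hdist {H : CHilbert} (f : H -> H) (x y : H) :
  is_isometric f -> hdist (f x) (f y) = hdist x y.
Proof.
  intros fI. apply Rle_antisym; apply Rle_of_sqr; try apply hdist_ge0;
    rewrite !hdist_sqr, !isometric_rin by assumption; lra.
Qed.

Lemma isometric_hnorm {H : CHilbert} (f : H -> H) (x : H) :
  is_isometric f -> hnorm (f x) = hnorm x.
Proof. intros fI. unfold hnorm. rewrite fI. reflexivity. Qed.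

(** * Translations and dilations in the affine group *)

Lemma Aff_eq (g h : Aff) : proj1_sig g = proj1_sig h -> g = h.
Proof.
  destruct g as [p hp], h as [q hq]. simpl. intros E. subst q.
  f_equal. apply proof_irrelevance.
Qed.

Definition Aff_mk (a b : R) (ha : 0 < a) : Aff := exist (fun p => 0 < fst p) (a, b) ha.
Definition ratio (g : Aff) : R := fst (proj1_sig g).
Definition offset (g : Aff) : R := snd (proj1_sig g).
Definition transl (s : R) : Aff := Aff_mk 1 s Rlt_0_1.
Definition dilat (t : R) : Aff := Aff_mk (exp t) 0 (exp_pos t).

Lemma ratio_gt0 (g : Aff) : 0 < ratio g.
Proof. exact (proj2_sig g). Qed.

Definition Aff_inv (g : Aff) : Aff :=
  Aff_mk (/ ratio g) (- offset g / ratio g) (Rinv_0_lt_compat _ (ratio_gt0 g)).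

Lemma Aff_mul_val (g h : Aff) :
  proj1_sig (Aff_mul g h) = (ratio g * ratio h, offset g + ratio g * offset h).
Proof. destruct g as [[a b] ha], h as [[a' b'] ha']. reflexivity. Qed.

Lemma Aff_val (g : Aff) : proj1_sig g = (ratio g, offset g).
Proof. destruct g as [[a b] ha]. reflexivity. Qed.

Lemma Aff_mulV (g : Aff) : Aff_mul g (Aff_inv g) = Aff_one.
Proof.
  apply Aff_eq. rewrite Aff_mul_val. unfold ratio at 2, offset at 2. simpl.
  assert (P := ratio_gt0 g). f_equal; field; lra.
Qed.

(** Translations form a normal subgroup; conjugation by an element of large ratio shrinks them to
    the identity, which drives the Mautner argument. *)
Lemma transl_mul (s : R) (g : Aff) :
  Aff_mul (transl s) g = Aff_mul g (transl (s / ratio g)).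
Proof.
  apply Aff_eq. rewrite !Aff_mul_val. unfold transl, ratio at 1 3 5, offset at 1 4. simpl.
  assert (P := ratio_gt0 g). f_equal; field; lra.
Qed.

Lemma transl_add (s t : R) : Aff_mul (transl s) (transl t) = transl (s + t).
Proof.
  apply Aff_eq. rewrite Aff_mul_val. unfold ratio, offset. simpl. f_equal; ring.
Qed.

Lemma dilat_add (s t : R) : dilat (s + t) = Aff_mul (dilat s) (dilat t).
Proof.
  apply Aff_eq. rewrite Aff_mul_val. unfold ratio, offset. simpl. rewrite exp_plus.
  f_equal; ring.
Qed.

Lemma dilat0 : dilat 0 = Aff_one.
Proof. apply Aff_eq. simpl. rewrite exp_0. reflexivity. Qed.

Lemma Aff_decomp (g : Aff) (t : R) :
  ratio g = exp t -> g = Aff_mul (transl (offset g)) (dilat t).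
Proof.
  intros E. apply Aff_eq. rewrite Aff_mul_val, Aff_val, E.
  unfold transl, dilat, ratio, offset; simpl. f_equal; ring.
Qed.

Lemma Aff_dist_transl (s : R) : Aff_dist (transl s) Aff_one = Rabs s.
Proof.
  rewrite <- sqrt_Rsqr_abs. unfold Aff_dist; simpl. f_equal. unfold Rsqr. ring.
Qed.

Lemma Aff_dist_dilat (s t : R) : Aff_dist (dilat s) (dilat t) = Rabs (exp s - exp t).
Proof.
  rewrite <- sqrt_Rsqr_abs. unfold Aff_dist; simpl. f_equal. unfold Rsqr. ring.
Qed.

Lemma Aff_dist_ratio (g h : Aff) : Rabs (ratio g - ratio h) <= Aff_dist g h.
Proof.
  unfold Aff_dist. rewrite (Aff_val g), (Aff_val h).
  rewrite <- sqrt_Rsqr_abs. apply sqrt_le_1_alt. unfold Rsqr.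
  assert (P := pow2_ge_0 (offset g - offset h)). lra.
Qed.

(** * Translation-invariant vectors, orbit hulls and the Mautner phenomenon *)

Definition transl_inv {H : CHilbert} (pi : Aff -> H -> H) (v : H) : Prop :=
  forall s, pi (transl s) v = v.

Lemma transl_inv_act {H : CHilbert} (pi : Aff -> H -> H) (g : Aff) (v : H) :
  unitary_rep Aff_grp H pi -> transl_inv pi v -> transl_inv pi (pi g v).
Proof.
  intros (_ & _ & _ & _ & pM & _) Nv s. cbn in pM.
  rewrite <- pM, transl_mul, pM, Nv. reflexivity.
Qed.

Lemma rin_act_inv {H : CHilbert} (pi : Aff -> H -> H) (g : Aff) (x y : H) :
  unitary_rep Aff_grp H pi -> rin (pi g x) y = rin x (pi (Aff_inv g) y).
Proof.
  intros (_ & _ & pI & _ & pM & p1 & _). cbn in pM, p1.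
  rewrite <- (isometric_rin (pi g) x _ (pI g)), <- pM, Aff_mulV.
  rewrite (p1 y). reflexivity.
Qed.

(** The dyadic convex hull of the translation orbit of [x]: closure under midpoints is all that the
    minimal norm argument asks for, and it allows proofs by induction. *)
Inductive transl_hull {H : CHilbert} (pi : Aff -> H -> H) (x : H) : H -> Prop :=
| transl_hull_orbit s : transl_hull pi x (pi (transl s) x)
| transl_hull_mid u v :
    transl_hull pi x u -> transl_hull pi x v -> transl_hull pi x (midpoint u v).

Lemma transl_hull_act {H : CHilbert} (pi : Aff -> H -> H) (x w : H) (s : R) :
  unitary_rep Aff_grp H pi -> transl_hull pi x w -> transl_hull pi x (pi (transl s) w).
Proof.
  intros (pD & pZ & _ & _ & pM & _) hw. cbn in pM.
  induction hw as [t|u v hu IHu hv IHv].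
  - rewrite <- pM, transl_add. constructor.
  - unfold midpoint, rscal. rewrite pZ, pD. now constructor.
Qed.

Lemma transl_hull_rin {H : CHilbert} (pi : Aff -> H -> H) (x w v : H) :
  unitary_rep Aff_grp H pi -> transl_inv pi v -> transl_hull pi x w ->
  rin w v = rin x v.
Proof.
  intros (_ & _ & pI & _) Nv hw. induction hw as [t|a b ha IHa hb IHb].
  - rewrite <- (Nv t) at 1. exact (isometric_rin _ _ _ (pI _)).
  - unfold midpoint. rin_expand. rewrite IHa, IHb. field.
Qed.

(** For an orbit point [w = n_t x], unitarity gives [<g u, x> = <n_t g u, n_t x> = <g n_(t/a) u, n_t
    x>], where [a = ratio g]. This differs from [<g u, w>] by at most the norm of [x] times the
    distance from [n_(t/a) u] to [u], which is small by continuity at the identity. Midpoints follow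
    by linearity. *)
Lemma transl_hull_mautner {H : CHilbert} (pi : Aff -> H -> H) (x w u : H) (eta : R) :
  unitary_rep Aff_grp H pi -> transl_hull pi x w -> 0 < eta ->
  exists A, forall g, A < ratio g -> Rabs (rin (pi g u) x - rin (pi g u) w) <= eta.
Proof.
  intros (pD & pZ & pI & _ & pM & p1 & pC) hw Heta. cbn in pM, p1.
  induction hw as [t|a b ha IHa hb IHb].
  - assert (Px := hnorm_ge0 x).
    destruct (pC u Aff_one (eta / (hnorm x + 1))) as (delta & Hd & HC).
    { apply Rdiv_lt_0_compat; lra. }
    (* Beyond this ratio, the conjugated translation [t / ratio g] has absolute value below
       [delta]. *)
    exists (Rabs t / delta). intros g Hg. assert (Pg := ratio_gt0 g).
    assert (E : rin (pi g u) x
                = rin (pi (transl t) (pi g u)) (pi (transl t) x)).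
    { symmetry. exact (isometric_rin _ _ _ (pI _)). }
    rewrite E, <- pM, transl_mul, pM.
    rewrite !(rin_sym _ (pi (transl t) x)).
    apply Rle_trans with (1 := rin_hdist_bound _ _ _).
    rewrite (isometric_hnorm _ _ (pI _)), (isometric_hdist _ _ _ (pI _)).
    assert (D : hdist (pi (transl (t / ratio g)) u) u < eta / (hnorm x + 1)).
    { rewrite <- (p1 u) at 2. apply HC.
      change (Aff_dist (transl (t / ratio g)) Aff_one < delta).
      rewrite Aff_dist_transl. unfold Rdiv. rewrite Rabs_mult, Rabs_inv.
      rewrite (Rabs_pos_eq (ratio g)) by lra.
      apply Rmult_lt_reg_r with (ratio g); [lra|].
      rewrite Rmult_assoc, Rinv_l, Rmult_1_r by lra.
      apply Rmult_lt_compat_l with (r := delta) in Hg; [|assumption].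
      replace (delta * (Rabs t / delta)) with (Rabs t) in Hg by (field; lra). lra. }
    apply Rle_trans with (hnorm x * (eta / (hnorm x + 1))).
    { apply Rmult_le_compat_l; lra. }
    apply Rmult_le_reg_r with (hnorm x + 1); [lra|].
    replace (hnorm x * (eta / (hnorm x + 1)) * (hnorm x + 1)) with (hnorm x * eta)
      by (field; lra). nra.
  - destruct IHa as [A HA], IHb as [B HB]. exists (Rmax A B). intros g Hg.
    assert (MA := Rmax_l A B). assert (MB := Rmax_r A B).
    specialize (HA g ltac:(lra)). specialize (HB g ltac:(lra)).
    unfold midpoint. rin_expand.
    apply Rabs_bounds in HA. apply Rabs_bounds in HB.
    apply Rabs_le. lra.
Qed.

(** Take [y] of minimal norm in the closure of the hull: uniqueness of the minimizer makes it
    invariant, and the other two properties pass to it from nearby hull points. *)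
Lemma transl_inv_projection {H : CHilbert} (pi : Aff -> H -> H) (x : H) :
  unitary_rep Aff_grp H pi ->
  exists y, transl_inv pi y /\
    (forall v, transl_inv pi v -> rin x v = rin y v) /\
    forall u eta, 0 < eta -> exists A, forall g, A < ratio g ->
      Rabs (rin (pi g u) x - rin (pi g u) y) <= eta.
Proof.
  intros rep. assert (rep' := rep).
  destruct rep' as (_ & _ & pI & _ & _ & p1 & _). cbn in p1.
  destruct (minimal_norm_point (transl_hull pi x)) as (d & y & low & appr).
  { exists (pi (transl 0) x). constructor. }
  { intros; now constructor. }
  exists y. split; [|split].
  - intros s. apply hdist_eq0. apply Rle_antisym; [|apply hdist_ge0].
    (* [w] and its translate both have almost minimal norm, hence are close. *)
    assert (B : forall e, 0 < e -> hdist (pi (transl s) y) y <= e * 4).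
    (* The bound [e] controls the distance from [w] to [y]; the bound [e * e] makes the
       parallelogram law give at most [2 * e] between [w] and its translate. The total is
       [e + 2 * e + e]. *)
    { intros e He. set (e' := Rmin e (e * e)).
      assert (E1 : e' <= e) by apply Rmin_l. assert (E2 : e' <= e * e) by apply Rmin_r.
      assert (E3 : 0 < e') by (apply Rmin_glb_lt; nra).
      destruct (appr e' E3) as (w & hw & dw & nw).
      assert (hsw := transl_hull_act pi x w s rep hw).
      assert (M := hdist_midpoint (pi (transl s) w) w).
      assert (L := low _ (transl_hull_mid pi x _ _ hsw hw)).
      rewrite (isometric_rin _ _ _ (pI _)) in M.
      assert (D : hdist (pi (transl s) w) w <= 2 * e) by (apply Rle_of_sqr; lra).
      assert (T1 := hdist_triangle (pi (transl s) y) (pi (transl s) w) y).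
      assert (T2 := hdist_triangle (pi (transl s) w) w y).
      rewrite (isometric_hdist _ _ _ (pI _)), (hdist_sym y w) in T1. lra. }
    apply (zero_of_bounds _ 4); [apply hdist_ge0|exact B].
  - intros v Nv. assert (Z : Rabs (rin x v - rin y v) <= 0).
    { apply (zero_of_bounds _ (hnorm v)); [apply Rabs_pos|]. intros e He.
      destruct (appr e He) as (w & hw & dw & _).
      rewrite <- (transl_hull_rin pi x w v rep Nv hw), !(rin_sym _ v).
      apply Rle_trans with (1 := rin_hdist_bound _ _ _).
      assert (P := hnorm_ge0 v). nra. }
    apply Rabs_bounds in Z. lra.
  - intros u eta He. assert (P := hnorm_ge0 u).
    (* Half of [eta] pays for replacing [y] by [w], the other half for the Mautner estimate; the
       [+ 1] covers [u] of norm zero. *)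
    destruct (appr (eta / (2 * (hnorm u + 1)))) as (w & hw & dw & _).
    { apply Rdiv_lt_0_compat; lra. }
    destruct (transl_hull_mautner pi x w u (eta / 2) rep hw) as [A HA]; [lra|].
    exists A. intros g Hg. specialize (HA g Hg).
    assert (B := rin_hdist_bound (pi g u) w y).
    rewrite (isometric_hnorm _ _ (pI _)) in B.
    assert (C : hnorm u * hdist w y <= eta / 2).
    { apply Rle_trans with (hnorm u * (eta / (2 * (hnorm u + 1)))).
      - apply Rmult_le_compat_l; lra.
      - apply Rmult_le_reg_r with (hnorm u + 1); [lra|].
        replace (hnorm u * (eta / (2 * (hnorm u + 1))) * (hnorm u + 1))
          with (hnorm u * (eta / 2)) by (field; lra). nra. }
    apply Rabs_bounds in HA. apply Rabs_bounds in B. apply Rabs_le. lra.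
Qed.

(** * The representation of [R] on the translation-invariant vectors *)

Lemma transl_inv_closed {H : CHilbert} (pi : Aff -> H -> H) (l : H) :
  unitary_rep Aff_grp H pi ->
  (forall e, 0 < e -> exists w, transl_inv pi w /\ hdist w l < e) -> transl_inv pi l.
Proof.
  intros (_ & _ & pI & _) appr s. apply hdist_eq0.
  apply Rle_antisym; [|apply hdist_ge0].
  apply (zero_of_bounds _ 2); [apply hdist_ge0|]. intros e He.
  destruct (appr e He) as (w & Nw & dw).
  assert (T := hdist_triangle (pi (transl s) l) (pi (transl s) w) l).
  rewrite (isometric_hdist _ _ _ (pI _)), (Nw s), (hdist_sym l w) in T. lra.
Qed.

Lemma sub_eq {T : Type} (P : T -> Prop) (x y : {v : T | P v}) :
  proj1_sig x = proj1_sig y -> x = y.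
Proof.
  destruct x as [x px], y as [y py]. simpl. intros ->. f_equal. apply proof_irrelevance.
Qed.

Lemma act_zero {H : CHilbert} (f : H -> H) :
  (forall x y, f (hadd x y) = hadd (f x) (f y)) -> f hzero = hzero.
Proof.
  intros fD. rewrite <- (hadd_oppl _ (hzero : H)) at 1.
  rewrite fD, (additive_opp f fD). apply hadd_oppl.
Qed.

(** The invariant vectors form a subtype whose equality reduces to that of [H] by proof irrelevance;
    completeness holds because this subspace is closed. *)
Definition transl_inv_space {H : CHilbert} (pi : Aff -> H -> H)
  (rep : unitary_rep Aff_grp H pi) : CHilbert.
Proof.
  assert (pD := proj1 rep). assert (pZ := proj1 (proj2 rep)).
  unshelve refine
   {| hv := {v : H | transl_inv pi v};
      hadd := fun x y => exist _ (hadd (proj1_sig x) (proj1_sig y)) _;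
      hzero := exist _ hzero _;
      hopp := fun x => exist _ (hopp (proj1_sig x)) _;
      hscal := fun a x => exist _ (hscal a (proj1_sig x)) _;
      hinner := fun x y => hinner (proj1_sig x) (proj1_sig y) |}.
  - intros s. rewrite pD. f_equal; [apply (proj2_sig x)|apply (proj2_sig y)].
  - intros s. apply act_zero, pD.
  - intros s. rewrite (additive_opp _ (pD _)). f_equal. apply (proj2_sig x).
  - intros s. rewrite pZ. f_equal. apply (proj2_sig x).
  - intros; apply sub_eq; apply hadd_assoc.
  - intros; apply sub_eq; apply hadd_comm.
  - intros; apply sub_eq; apply hadd_0l.
  - intros; apply sub_eq; apply hadd_oppl.
  - intros; apply sub_eq; apply hscal_1.
  - intros; apply sub_eq; apply hscal_assoc.
  - intros; apply sub_eq; apply hscal_addr.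
  - intros; apply sub_eq; apply hscal_addl.
  - intros; apply hinner_addl.
  - intros; apply hinner_scall.
  - intros; apply hinner_sym.
  - intros; apply hinner_pos.
  - intros x E; apply sub_eq; now apply hinner_def.
  - intros u Cu. destruct (hcomplete H (fun n => proj1_sig (u n)) Cu) as [l Hl].
    assert (Nl : transl_inv pi l).
    { apply (transl_inv_closed pi l rep). intros e He. destruct (Hl e He) as [N HN].
      exists (proj1_sig (u N)). split; [apply (proj2_sig (u N))|apply HN; lia]. }
    exists (exist _ l Nl). exact Hl.
Defined.

Definition dilat_act {H : CHilbert} (pi : Aff -> H -> H)
  (rep : unitary_rep Aff_grp H pi) (t : R) (v : transl_inv_space pi rep) :
  transl_inv_space pi rep :=
  exist _ (pi (dilat t) (proj1_sig v)) (transl_inv_act pi _ _ rep (proj2_sig v)).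

Lemma dilat_rep {H : CHilbert} (pi : Aff -> H -> H) (rep : unitary_rep Aff_grp H pi) :
  unitary_rep Radd_grp (transl_inv_space pi rep) (dilat_act pi rep).
Proof.
  assert (rep' := rep). destruct rep' as (pD & pZ & pI & _ & pM & p1 & pC).
  cbn in pM, p1.
  assert (aM : forall s t v,
    dilat_act pi rep (s + t) v = dilat_act pi rep s (dilat_act pi rep t v)).
  { intros s t v. apply sub_eq. simpl. rewrite dilat_add. apply pM. }
  assert (a0 : forall v, dilat_act pi rep 0 v = v).
  { intros v. apply sub_eq. simpl. rewrite dilat0. apply p1. }
  split; [|split; [|split; [|split; [|split; [|split]]]]].
  - intros g x y. apply sub_eq. apply pD.
  - intros g a x. apply sub_eq. apply pZ.
  - intros g x y. apply pI.
  - intros g y. exists (dilat_act pi rep (- g) y). rewrite <- aM, Rplus_opp_r. apply a0.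
  - exact aM.
  - exact a0.
  - intros x t0 e He. destruct (pC (proj1_sig x) (dilat t0) e He) as (d & Hd & HC).
    destruct (derivable_continuous_pt exp t0 (derivable_pt_exp t0) d Hd)
      as (d' & Hd' & Hexp).
    exists d'. split; [exact Hd'|]. intros t Ht. cbn in Ht.
    apply (HC (dilat t)).
    change (Aff_dist (dilat t) (dilat t0) < d). rewrite Aff_dist_dilat.
    (* The continuity statement for [exp] concerns only points distinct from [t0], so [t = t0] is
       treated apart. *)
    destruct (Req_dec t t0) as [->|ne].
    + rewrite Rminus_diag, Rabs_R0. exact Hd.
    + apply (Hexp t). split; [|exact Ht]. split; [exact I|congruence].
Qed.

(** * Kazhdan sets of [R] are unbounded *)

Lemma Cx_component_le (z : Cx) :
  Rabs (fst z) <= sqrt (fst z * fst z + snd z * snd z) /\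
  Rabs (snd z) <= sqrt (fst z * fst z + snd z * snd z).
Proof.
  split; rewrite <- sqrt_Rsqr_abs; apply sqrt_le_1_alt; unfold Rsqr; nra.
Qed.

Lemma Cx_abs_le (z : Cx) :
  sqrt (fst z * fst z + snd z * snd z) <= Rabs (fst z) + Rabs (snd z).
Proof.
  assert (P := Rabs_pos (fst z)). assert (P' := Rabs_pos (snd z)).
  apply Rle_of_sqr; [lra|]. rewrite sqrt_sqrt by nra.
  assert (Rabs (fst z) * Rabs (fst z) = fst z * fst z)
    by (rewrite <- Rabs_mult; apply Rabs_pos_eq; nra).
  assert (Rabs (snd z) * Rabs (snd z) = snd z * snd z)
    by (rewrite <- Rabs_mult; apply Rabs_pos_eq; nra).
  nra.
Qed.

Ltac Cx_ring :=
  intros; unfold Cadd, Cmul, Cconj, C0, Defs.C1, Cre in *; simpl; f_equal; ring.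

Definition Cx_hilbert : CHilbert.
Proof.
  unshelve refine
   {| hv := Cx; hadd := Cadd; hzero := C0; hopp := fun z => (- fst z, - snd z);
      hscal := Cmul; hinner := fun z w => Cmul z (Cconj w) |}; try Cx_ring.
  - intros [a b]. Cx_ring.
  - intros [a b]. Cx_ring.
  - intros [a b]. unfold Cre, Cmul, Cconj; simpl. nra.
  - intros [a b]. unfold Cre, Cmul, Cconj, C0; simpl. intros E. f_equal; nra.
  - intros u Cu.
    assert (E : forall z : Cx,
      Cre (Cmul z (Cconj z)) = fst z * fst z + snd z * snd z).
    { intros z. unfold Cre, Cmul, Cconj; simpl. ring. }
    destruct (R_complete (fun n => fst (u n))) as [l Hl].
    { intros e He. destruct (Cu e He) as [N HN]. exists N. intros p q Hp Hq.
      specialize (HN p q Hp Hq). rewrite E in HN.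
      exact (Rle_lt_trans _ _ _ (proj1 (Cx_component_le _)) HN). }
    destruct (R_complete (fun n => snd (u n))) as [m Hm].
    { intros e He. destruct (Cu e He) as [N HN]. exists N. intros p q Hp Hq.
      specialize (HN p q Hp Hq). rewrite E in HN.
      exact (Rle_lt_trans _ _ _ (proj2 (Cx_component_le _)) HN). }
    exists (l, m). intros e He.
    destruct (Hl (e / 2)) as [N1 H1]; [lra|]. destruct (Hm (e / 2)) as [N2 H2]; [lra|].
    exists (N1 + N2)%nat. intros n Hn. rewrite E.
    apply Rle_lt_trans with (1 := Cx_abs_le _).
    specialize (H1 n ltac:(lia)). specialize (H2 n ltac:(lia)).
    unfold Rdist in H1, H2. unfold Cadd; simpl.
    unfold Rminus in H1, H2. lra.
Defined.

(** Multiplication by [e^(i s t)], the unitary character of frequency [s]. *)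
Definition character (s t : R) (z : Cx_hilbert) : Cx_hilbert :=
  Cmul (cos (s * t), sin (s * t)) z.

Lemma sin_abs_le (x : R) : Rabs (sin x) <= Rabs x.
Proof.
  assert (pos : forall y, 0 < y -> Rabs (sin y) <= y).
  { intros y Hy. apply Rabs_le. assert (B := SIN_bound y). assert (U := sin_lt_x y Hy).
    split; [|lra]. destruct (Rle_lt_dec y 1).
    - assert (0 <= sin y); [|lra]. apply sin_ge_0; [lra|].
      assert (P := PI2_1). lra.
    - lra. }
  destruct (Rtotal_order x 0) as [n|[->|p]].
  - rewrite <- Rabs_Ropp, <- sin_neg, <- (Rabs_Ropp x), (Rabs_pos_eq (- x)) by lra.
    apply pos. lra.
  - rewrite sin_0. lra.
  - rewrite (Rabs_pos_eq x) by lra. now apply pos.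
Qed.

Lemma character_isometric (s t : R) : is_isometric (character s t).
Proof.
  intros [a b] [c d]. cbn. unfold Cmul, Cconj; simpl.
  assert (T := sin2_cos2 (s * t)). unfold Rsqr in T.
  set (S := sin (s * t)) in *. set (K := cos (s * t)) in *.
  f_equal.
  - transitivity ((S * S + K * K) * (a * c + b * d)); [ring|]. rewrite T. ring.
  - transitivity ((S * S + K * K) * (b * c - a * d)); [ring|]. rewrite T. ring.
Qed.

Lemma character_add (s t t' : R) (z : Cx_hilbert) :
  character s (t + t') z = character s t (character s t' z).
Proof.
  unfold character. rewrite Rmult_plus_distr_l, cos_plus, sin_plus.
  unfold Cmul; simpl. f_equal; ring.
Qed.

Lemma character0 (s : R) (z : Cx_hilbert) : character s 0 z = z.
Proof.
  destruct z as [a b]. unfold character. rewrite Rmult_0_r, cos_0, sin_0. Cx_ring.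
Qed.

(** With [theta = s * t], the squared displacement is [2 (1 - cos theta) |z|^2 = 4 sin^2(theta / 2)
    |z|^2], and [|sin u| <= |u|]. *)
Lemma character_hdist (s t : R) (z : Cx_hilbert) :
  hdist (character s t z) z <= Rabs (s * t) * hnorm z.
Proof.
  apply Rle_of_sqr.
  { apply Rmult_le_pos; [apply Rabs_pos|apply hnorm_ge0]. }
  rewrite hdist_sqr, (isometric_rin _ _ _ (character_isometric s t)).
  replace (Rabs (s * t) * hnorm z * (Rabs (s * t) * hnorm z))
    with (Rabs (s * t) * Rabs (s * t) * (hnorm z * hnorm z)) by ring.
  rewrite hnorm_sqr.
  assert (E : rin (character s t z) z = cos (s * t) * rin z z).
  { unfold rin, Cre. cbn. unfold Cmul, Cconj; simpl. ring. }
  rewrite E. assert (P := rin_pos z).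
  assert (C : 2 - 2 * cos (s * t) <= Rabs (s * t) * Rabs (s * t)).
  { replace (s * t) with (2 * (s * t / 2)) at 1 by field. rewrite cos_2a_sin.
    assert (B := sin_abs_le (s * t / 2)).
    assert (B2 := Rmult_le_compat _ _ _ _ (Rabs_pos _) (Rabs_pos _) B B).
    rewrite <- !Rabs_mult in B2. rewrite <- Rabs_mult.
    rewrite !Rabs_pos_eq in B2 by nra. rewrite Rabs_pos_eq by nra. lra. }
  nra.
Qed.

Lemma character_rep (s : R) : unitary_rep Radd_grp Cx_hilbert (character s).
Proof.
  split; [|split; [|split; [|split; [|split; [|split]]]]].
  - intros g x y. unfold character; cbn. Cx_ring.
  - intros g a x. unfold character; cbn. Cx_ring.
  - intros g. exact (character_isometric s g).
  - intros g y. exists (character s (- g) y).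
    rewrite <- character_add, Rplus_opp_r. apply character0.
  - exact (character_add s).
  - exact (character0 s).
  - intros z t0 e He. cbn in t0. set (K := Rabs s * hnorm z).
    assert (PK : 0 <= K) by (apply Rmult_le_pos; [apply Rabs_pos|apply hnorm_ge0]).
    exists (e / (K + 1)). split; [apply Rdiv_lt_0_compat; lra|].
    intros t Ht. cbn in t, Ht.
    replace (character s t z) with (character s t0 (character s (t - t0) z))
      by (rewrite <- character_add; f_equal; ring).
    rewrite (isometric_hdist _ _ _ (character_isometric s t0)).
    apply Rle_lt_trans with (1 := character_hdist _ _ _).
    rewrite Rabs_mult.
    replace (Rabs s * Rabs (t - t0) * hnorm z) with (K * Rabs (t - t0))
      by (unfold K; ring).
    apply Rle_lt_trans with (K * (e / (K + 1))).
    { apply Rmult_le_compat_l; lra. }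
    apply Rmult_lt_reg_r with (K + 1); [lra|].
    replace (K * (e / (K + 1)) * (K + 1)) with (K * e) by (field; lra). nra.
Qed.

Lemma Kazhdan_unbounded (S : R -> Prop) (M : R) :
  Kazhdan_set Radd_grp S -> exists t, S t /\ M < Rabs t.
Proof.
  intros (eps & Heps & HK). apply NNPP. intros no.
  assert (bd : forall t, S t -> Rabs t <= Rabs M).
  { intros t St. assert (L := Rle_abs M). destruct (Rle_lt_dec (Rabs t) M); [lra|].
    exfalso; eauto. }
  (* A frequency this low moves the unit vector [1] by at most [eps / 2] at all times of absolute
     value at most [Rabs M]. *)
  assert (PM := Rabs_pos M). set (s := eps / (2 * (Rabs M + 1))).
  assert (Hs : 0 < s) by (apply Rdiv_lt_0_compat; lra).
  assert (n1 : hnorm (Defs.C1 : Cx_hilbert) = 1).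
  { transitivity (sqrt 1); [|apply sqrt_1]. unfold hnorm. f_equal. cbn. ring. }
  destruct (HK Cx_hilbert (character s) (character_rep s) (Defs.C1 : Cx_hilbert))
    as (v & nz & Hv).
  { exists (eps / 2). rewrite n1. split; [lra|]. split; [lra|]. intros t St.
    apply Rle_trans with (1 := character_hdist _ _ _). rewrite n1, Rmult_1_r.
    rewrite Rabs_mult, (Rabs_pos_eq s) by lra.
    apply Rle_trans with (s * (Rabs M + 1)).
    - apply Rmult_le_compat_l; [lra|]. specialize (bd t St). lra.
    - unfold s. right. field. lra. }
  (* At time [PI / s] the character equals [-1], so an invariant vector satisfies [v = - v] and
     vanishes. *)
  apply nz. specialize (Hv (PI / s)). revert Hv. unfold character.
  replace (s * (PI / s)) with PI by (field; lra). rewrite cos_PI, sin_PI.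
  destruct v as [a b]. unfold Cmul; simpl. intros E. injection E as E1 E2.
  cbn. unfold C0. f_equal; lra.
Qed.

(** * The two implications *)

(** Representations of [R] are pulled back along the continuous homomorphism sending [g] to
    [ln (ratio g)]. It maps [Q] into [Q0 Q], and dilations show that it is onto, so invariant
    vectors are the same. *)
Lemma Kazhdan_Aff_R (Q : Aff -> Prop) :
  Kazhdan_set Aff_grp Q -> Kazhdan_set Radd_grp (Q0 Q).
Proof.
  intros (eps & Heps & HK). exists eps. split; [exact Heps|].
  intros H pi rep x (c & Hc & Hce & Hx). assert (rep' := rep).
  destruct rep' as (pD & pZ & pI & pS & pM & p1 & pC). cbn in pM, p1.
  assert (lnM : forall g h, ln (ratio (Aff_mul g h)) = ln (ratio g) + ln (ratio h)).
  { intros g h. unfold ratio at 1. rewrite Aff_mul_val. simpl.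
    apply ln_mult; apply ratio_gt0. }
  destruct (HK H (fun g => pi (ln (ratio g)))) with (x := x) as (v & nz & Hv).
  - split; [|split; [|split; [|split; [|split; [|split]]]]].
    + intros g; apply pD.
    + intros g; apply pZ.
    + intros g; apply pI.
    + intros g; apply pS.
    + intros g h y. cbn. rewrite lnM. apply pM.
    + intros y. cbn. rewrite ln_1. apply p1.
    + intros y g0 e He. destruct (pC y (ln (ratio g0)) e He) as (d & Hd & HC).
      assert (P0 := ratio_gt0 g0).
      destruct (derivable_continuous_pt ln (ratio g0)
        (exist _ _ (derivable_pt_lim_ln _ P0)) d Hd) as (d' & Hd' & Hln).
      exists d'. split; [exact Hd'|]. intros g Hg. apply HC. cbn.
      destruct (Req_dec (ratio g) (ratio g0)) as [E|ne].
      * rewrite E, Rminus_diag, Rabs_R0. exact Hd.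
      * apply (Hln (ratio g)). split; [split; [exact I|congruence]|].
        apply Rle_lt_trans with (2 := Hg). apply Aff_dist_ratio.
  - exists c. split; [exact Hc|]. split; [exact Hce|]. intros g Qg. apply Hx.
    exists g. split; [exact Qg|]. rewrite exp_ln; [reflexivity|apply ratio_gt0].
  - exists v. split; [exact nz|]. intros t. specialize (Hv (dilat t)).
    unfold ratio in Hv. simpl in Hv. rewrite ln_exp in Hv. exact Hv.
Qed.

(** The squared displacement of [z] by [g] is [2 <z, z> - 2 <g z, z>], and some [g] in [Q] makes the
    last term arbitrarily small. *)
Lemma orthogonal_part_bound {H : CHilbert} (pi : Aff -> H -> H) (Q : Aff -> Prop)
  (z : H) (c : R) :
  unitary_rep Aff_grp H pi -> 0 <= c ->
  (forall M, exists t, Q0 Q t /\ M < Rabs t) ->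
  (forall eta, 0 < eta -> exists A, forall g, A < ratio g ->
     Rabs (rin (pi g z) z) <= eta) ->
  (forall g, Q g -> hdist (pi g z) z <= c) ->
  2 * rin z z <= c * c.
Proof.
  intros rep Hc unb mix Hz. assert (rep' := rep).
  destruct rep' as (_ & _ & pI & _).
  apply Rle_plus_epsilon. intros e He.
  destruct (mix (e / 2)) as [A HA]; [lra|].
  (* This threshold yields [exp (Rabs t) > A]; the maximum with [1] keeps the argument of [ln]
     positive. *)
  destruct (unb (ln (Rmax A 1))) as (t & (g & Qg & Eg) & Ht).
  change (ratio g = exp t) in Eg.
  assert (MA := Rmax_l A 1). assert (M1 := Rmax_r A 1).
  assert (big : A < exp (Rabs t)).
  { apply exp_increasing in Ht. rewrite exp_ln in Ht; lra. }
  assert (B : Rabs (rin (pi g z) z) <= e / 2).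
  { unfold Rabs in big at 1. destruct (Rcase_abs t).
    (* For negative [t] it is the inverse of [g] that has large ratio, and
       [<g z, z> = <z, g^(-1) z>]. *)
    - rewrite rin_act_inv, rin_sym by assumption. apply HA.
      unfold ratio, Aff_inv, Aff_mk; simpl. rewrite Eg, <- exp_Ropp. exact big.
    - apply HA. lra. }
  assert (D := hdist_sqr (pi g z) z).
  rewrite (isometric_rin _ _ _ (pI g)) in D.
  specialize (Hz g Qg). assert (P := hdist_ge0 (pi g z) z).
  apply Rabs_bounds in B. nra.
Qed.

Lemma Kazhdan_R_Aff (Q : Aff -> Prop) :
  Kazhdan_set Radd_grp (Q0 Q) -> Kazhdan_set Aff_grp Q.
Proof.
  intros HQ. assert (unb := fun M => Kazhdan_unbounded _ M HQ).
  destruct HQ as (eps & Heps & HK).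
  (* The bound [1] gives [c < |x|], hence [2 |z|^2 <= |x|^2] and [|x| <= 2 |y|]; the bound [eps / 2]
     then gives [c < eps |y|]. *)
  exists (Rmin 1 (eps / 2)). split; [apply Rmin_glb_lt; lra|].
  intros H pi rep x (c & Hc & Hce & Hx). assert (rep' := rep).
  destruct rep' as (pD & pZ & pI & pS & pM & p1 & pC). cbn in pM, p1.
  destruct (transl_inv_projection pi x rep) as (y & Ny & Oy & mix).
  set (z := hadd x (hopp y)).
  assert (Oz : forall v, transl_inv pi v -> rin z v = 0).
  { intros v Nv. unfold z. rin_expand. rewrite (Oy v Nv). ring. }
  assert (Ogz : forall g v, transl_inv pi v -> rin (pi g z) v = 0).
  { intros g v Nv. rewrite rin_act_inv by assumption.
    apply Oz. now apply transl_inv_act. }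
  assert (Ex : rin x x = rin y y + rin z z).
  { unfold z. rin_expand. rewrite (rin_sym y x), (Oy y Ny). ring. }
  assert (pz : forall g, pi g z = hadd (pi g x) (hopp (pi g y))).
  { intros g. unfold z. rewrite pD, (additive_opp _ (pD g)). reflexivity. }
  (* Pythagoras: [g y - y] is translation-invariant, while [g z - z] is orthogonal to all invariant
     vectors. *)
  assert (split2 : forall g, hdist (pi g x) x * hdist (pi g x) x
    = hdist (pi g y) y * hdist (pi g y) y + hdist (pi g z) z * hdist (pi g z) z).
  { intros g. rewrite !hdist_sqr, !(isometric_rin _ _ _ (pI g)), Ex.
    assert (A1 := Ogz g y Ny).
    assert (A2 := Oz _ (transl_inv_act pi g y rep Ny)).
    rewrite pz in *. unfold z in A1, A2 |- *. revert A1 A2. rin_expand.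
    rewrite (rin_sym x (pi g y)), (rin_sym y (pi g y)). lra. }
  assert (Hyz : forall g, Q g -> hdist (pi g y) y <= c /\ hdist (pi g z) z <= c).
  { intros g Qg. specialize (Hx g Qg). specialize (split2 g).
    assert (P1 := hdist_ge0 (pi g x) x). split; apply Rle_of_sqr; nra. }
  assert (Bz : 2 * rin z z <= c * c).
  { apply (orthogonal_part_bound pi Q); auto.
    - intros eta He. destruct (mix z eta He) as [A HA]. exists A. intros g Hg.
      specialize (HA g Hg). unfold z at 2. rin_expand. exact HA.
    - intros g Qg. now apply Hyz. }
  assert (Px := hnorm_ge0 x). assert (Py := hnorm_ge0 y).
  assert (Sx := hnorm_sqr x). assert (Sy := hnorm_sqr y).
  assert (m1 : Rmin 1 (eps / 2) <= 1) by apply Rmin_l.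
  assert (m2 : Rmin 1 (eps / 2) <= eps / 2) by apply Rmin_r.
  assert (c1 : c < hnorm x) by nra.
  assert (c2 : c < eps / 2 * hnorm x) by nra.
  assert (xy : hnorm x <= 2 * hnorm y) by (apply Rle_of_sqr; nra).
  destruct (HK _ _ (dilat_rep pi rep) (exist _ y Ny)) as (v & nz & Hv).
  { exists c. split; [exact Hc|]. split.
    - change (c < eps * hnorm y). nra.
    - intros t (g & Qg & Eg).
      change (hdist (pi (dilat t) y) y <= c).
      (* Writing [g] as a translation after a dilation, the translation fixes the invariant vector
         [pi (dilat t) y]. *)
      assert (E : pi g y = pi (dilat t) y).
      { rewrite (Aff_decomp g t Eg), pM. now apply transl_inv_act. }
      rewrite <- E. now apply Hyz. }
  exists (proj1_sig v). split.
  - intros E. apply nz. apply sub_eq. exact E.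
  (* The vector is fixed by dilations by the choice of [v], and by translations as an element of the
     subspace; every [g] is a product of the two. *)
  - intros g. cbn in g. rewrite (Aff_decomp g (ln (ratio g)))
      by (rewrite exp_ln; [reflexivity|apply ratio_gt0]).
    rewrite pM. specialize (Hv (ln (ratio g))).
    apply (f_equal (@proj1_sig _ _)) in Hv. simpl in Hv. rewrite Hv.
    apply (proj2_sig v).
Qed.

Theorem mainTheorem16 (Q : Aff -> Prop) :
  Kazhdan_set Aff_grp Q <-> Kazhdan_set Radd_grp (Q0 Q).
Proof. split; [apply Kazhdan_Aff_R|apply Kazhdan_R_Aff]. Qed.
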